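(* Let $\mu,\nu$ be Borel probability measures on $\mathbb{R}$ with compact support and without atoms, let $\lambda_C:=\mathcal{W}_\infty(\mu,\nu)$, and let $\bar\gamma\in\mathcal{O}_\infty(\mu,\nu)$ be an $\infty$-cyclically monotone transport plan. With the intervals $[a_i,b_i]$ and $[c_i,d_i]$, $i\in I$, associated with $\bar\gamma$ as defined in the context, denote for each $i\in I$ $$\mu_i:=\mu\lfloor[a_i,b_i]\quad\text{and}\quad\nu_i:=\nu\lfloor[c_i,d_i].$$ Then, for each $i$, $\mu_i$ and $\nu_i$ have the same total mass. Moreover, the optimal plans $\gamma\in\mathcal{O}_\infty(\mu,\nu)$ are exactly those which can be written as $$\gamma=(\mathrm{id}\times(\mathrm{id}+\lambda_C))_\#(\mu\lfloor M_{\bar\gamma}^+)+(\mathrm{id}\times(\mathrm{id}-\lambda_C))_\#(\mu\lfloor M_{\bar\gamma}^-)+\sum_{i\in I}\gamma_i$$ where, for each $i$, $\gamma_i$ is a transport plan from $\mu_i$ to $\nu_i$ such that $|y-x|\le\lambda_C$ for $\gamma_i$-a.e. $(x,y)$.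
   Context: For finite positive measures $\mu,\nu$ of equal mass, $\Pi(\mu,\nu)$ is the set of positive Borel measures on $\mathbb{R}\times\mathbb{R}$ with first marginal $\mu$ and second marginal $\nu$ (transport plans from $\mu$ to $\nu$). $\mathcal{W}_\infty(\mu,\nu):=\min_{\gamma\in\Pi(\mu,\nu)}\ \gamma\text{-ess sup}\,|x-y|$, and $\mathcal{O}_\infty(\mu,\nu)$ is the set of minimizers. $\operatorname{spt}$ denotes the support, $\mu\lfloor A$ the restriction of $\mu$ to $A$, $T_\#$ the push-forward, and $(\mathrm{id}\times T)(x)=(x,T(x))$. A plan $\gamma\in\Pi(\mu,\nu)$ is $\infty$-cyclically monotone if for all $n\in\mathbb{N}$ and $(x_0,y_0),\dots,(x_n,y_n)\in\operatorname{spt}(\gamma)$, $\max_{0\le i\le n}|x_i-y_i|\le\max_{0\le i\le n}|x_i-y_{i+1}|$, where $y_{n+1}=y_0$. $M_{\bar\gamma}^+:=\{x : (x,x+\lambda_C)\in\operatorname{spt}(\bar\gamma)\}$, $M_{\bar\gamma}^-:=\{x : (x,x-\lambda_C)\in\operatorname{spt}(\bar\gamma)\}$, $M_{\bar\gamma}:=M_{\bar\gamma}^+\cup M_{\bar\gamma}^-$ (compact sets). Let $a<b$ be the lower and upper bounds of $\operatorname{spt}\mu$ and $c<d$ those of $\operatorname{spt}\nu$. Write $(a,b)\setminus M_{\bar\gamma}=\bigcup_{i\in I}(a_i,b_i)$, where $I$ is at most countable and the $(a_i,b_i)$ are the (distinct) maximal open intervals contained in $(a,b)\setminus M_{\bar\gamma}$;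 in particular all $a_i,b_i$ belong to $M_{\bar\gamma}\cup\{a,b\}$. For each $i$ set $c_i=c$ if $a_i=a$; $c_i=a_i+\lambda_C$ if $a_i\in M_{\bar\gamma}^+$ and $a_i\ne a$; $c_i=a_i-\lambda_C$ if $a_i\in M_{\bar\gamma}^-$, $a_i\notin M_{\bar\gamma}^+$ and $a_i\neq a$; $d_i=d$ if $b_i=b$; $d_i=b_i-\lambda_C$ if $b_i\in M_{\bar\gamma}^-$ and $b_i\neq b$; $d_i=b_i+\lambda_C$ if $b_i\in M_{\bar\gamma}^+$, $b_i\notin M_{\bar\gamma}^-$ and $b_i\ne b$.
   Formalization: The description of the optimal plans is stated only for λ_C > 0; when λ_C = 0 one has μ = ν and M⁺ = M⁻ = spt μ, so the right-hand side has mass at least 2 and the claim fails. The equal-mass claim is stated without this restriction. *)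

(* Defs.v *)
From HB Require Import structures.
From mathcomp Require Import all_boot all_order all_algebra.
From mathcomp Require Import all_classical all_reals all_analysis.
From mathcomp Require Import ess_sup_inf measurable_realfun.
Import Order.TTheory GRing.Theory Num.Theory.
Import numFieldTopology.Exports numFieldNormedType.Exports.
Set Implicit Arguments.
Unset Strict Implicit.
Unset Printing Implicit Defensive.
Local Open Scope classical_set_scope.
Local Open Scope ring_scope.

Section support.
Context {T : topologicalType} {R : realType}.

(** Stated for arbitrary set functions so that it applies to measures whose
    sigma-algebra is not bundled with the topology; the neighbourhoods are taken
    open so that they are measurable in the cases of interest. *)
Definition spt (m : set T -> \bar R) : set T :=
  [set x | forall U : set T, open_nbhs x U -> (0 < m U)%E].

Lemma closed_spt (m : set T -> \bar R) : closed (spt m).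
Proof.
move=> x clx U Ux.
have [y [sy Uy]] := clx U (open_nbhs_nbhs Ux).
by apply: sy; split=> //; case: Ux.
Qed.

End support.

Section plans.
Context {R : realType}.
Local Notation borelR := (measurableTypeR R).
Local Notation borelR2 := (measurableTypeR R * measurableTypeR R)%type.
Implicit Types (mu nu : {measure set borelR -> \bar R})
  (g : {measure set borelR2 -> \bar R}).

(** Values of a MathComp-Analysis measure on non-measurable sets are not
    significant, so equalities of measures are only asserted on measurable
    sets. *)
Definition plan mu nu : set {measure set borelR2 -> \bar R} :=
  [set g | (forall A : set borelR, measurable A -> pushforward g fst A = mu A) /\
           (forall A : set borelR, measurable A -> pushforward g snd A = nu A)].

Definition cost_infty g : \bar R :=
  ess_sup g (fun z : borelR2 => `|z.1 - z.2|%:E).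

Definition W_infty mu nu : \bar R := ereal_inf (cost_infty @` plan mu nu).

Definition O_infty mu nu : set {measure set borelR2 -> \bar R} :=
  [set g | plan mu nu g /\ cost_infty g = W_infty mu nu].

(** [W_infty mu nu] is a real number when [mu] and [nu] are compactly supported
    with the same mass. *)
Definition lambdaC mu nu : R := fine (W_infty mu nu).

(** [ordS i] is the cyclic successor of [i], and the default value [0] of the
    maxima is harmless since they are taken over nonempty families of
    nonnegative numbers. *)
Definition infty_cyclically_monotone g : Prop :=
  forall (n : nat) (p : 'I_n.+1 -> R * R),
    (forall i, spt (g : set (R * R) -> \bar R) (p i)) ->
    \big[Num.max/0]_(i < n.+1) `|(p i).1 - (p i).2| <=
    \big[Num.max/0]_(i < n.+1) `|(p i).1 - (p (ordS i)).2|.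

(** [Mplus l g] and [Mminus l g] coincide when [l = 0]. *)
Definition Mplus (l : R) g : set R :=
  [set x | spt (g : set (R * R) -> \bar R) (x, x + l)].

Definition Mminus (l : R) g : set R :=
  [set x | spt (g : set (R * R) -> \bar R) (x, x - l)].

Lemma measurable_Mplus (l : R) g : measurable (Mplus l g : set borelR).
Proof.
apply: closed_measurable.
apply: (@preimage_closed R (R * R)%type (fun x => (x, x + l)));
  last exact: closed_spt.
move=> x _.
apply: (@cvg_pair _ _ _ (nbhs x) (nbhs x) (nbhs (x + l)) _ _ _ id
          (fun y => y + l)).
  exact: cvg_id.
by apply: cvgD; [exact: cvg_id|exact: cvg_cst].
Qed.

Lemma measurable_Mminus (l : R) g : measurable (Mminus l g : set borelR).
Proof. exact: (measurable_Mplus (- l)). Qed.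

Definition id_x_shift (l : R) (x : borelR) : borelR2 := (x, x + l).

(** The maximal open intervals [(p.1, p.2)] contained in [(a, b) \ M]; the set
    of such pairs of endpoints is itself used as the index set [I]. *)
Definition gaps (a b : R) (M : set R) : set (R * R) :=
  [set p | [/\ p.1 < p.2,
     [set` `]p.1, p.2[] `<=` [set` `]a, b[] `\` M &
     forall q : R * R, [set` `]p.1, p.2[] `<=` [set` `]q.1, q.2[] ->
       [set` `]q.1, q.2[] `<=` [set` `]a, b[] `\` M -> q = p]].

Section intervals.
Variables (mu nu : {measure set borelR -> \bar R})
  (gbar : {measure set borelR2 -> \bar R}).
Let l := lambdaC mu nu.
Let a := inf (spt (mu : set R -> \bar R)).
Let b := sup (spt (mu : set R -> \bar R)).
Let c := inf (spt (nu : set R -> \bar R)).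
Let d := sup (spt (nu : set R -> \bar R)).

Definition gap_index : set (R * R) :=
  gaps a b (Mplus l gbar `|` Mminus l gbar).

(** For [p] in [gap_index], [p.1] lies in [M] or equals [a], so the last branch
    is the case where [p.1] is in [Mminus] only; dually for [hi]. *)
Definition lo (p : R * R) : R :=
  if p.1 == a then c
  else if p.1 \in Mplus l gbar then p.1 + l
  else p.1 - l.

Definition hi (p : R * R) : R :=
  if p.2 == b then d
  else if p.2 \in Mminus l gbar then p.2 - l
  else p.2 + l.

Definition mu_gap (p : R * R) : {measure set borelR -> \bar R} :=
  mrestr mu (measurable_itv `[p.1, p.2]).

Definition nu_gap (p : R * R) : {measure set borelR -> \bar R} :=
  mrestr nu (measurable_itv `[lo p, hi p]).

End intervals.
End plans.

(* Main.v *)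
(** Call a plan concentrated if [|x - y| <= l] almost everywhere; optimal plans
    are the concentrated ones. If [t] is a point of [Mplus], cyclic monotonicity
    applied to [(t, t + l)] and to one further point shows that [gbar] does not
    charge [{x > t, y < t + l}], so [mu] and [nu] have the same mass on
    [x <= t] and on [y <= t + l]. Any concentrated plan sends the first
    half-line into the second, hence by equality of masses it does not charge
    [{x > t, y <= t + l}] either. Letting [t] increase to a point [x] of [Mplus]
    pins the plan to the graph [y = x + l] over [Mplus], and taking [t] to be
    the endpoints of a gap shows that the plan maps the gap to [[lo, hi]];
    [Mminus] is symmetric. Conversely, a sum of plans as in the theorem has the
    same marginals as the decomposition of [gbar] itself. *)

Require Import Defs.
From mathcomp Require Import all_boot all_order all_algebra.
From mathcomp Require Import all_classical all_reals all_analysis.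
From mathcomp Require Import ess_sup_inf measurable_realfun lra.
Import Order.TTheory GRing.Theory Num.Theory.
Import numFieldTopology.Exports numFieldNormedType.Exports.
Set Implicit Arguments.
Unset Strict Implicit.
Unset Printing Implicit Defensive.
Local Open Scope classical_set_scope.
Local Open Scope ring_scope.

(** * Comparing measures of sets up to null sets *)

Section negligible_sets.
Context {d : measure_display} {T : measurableType d} {R : realType}.
Variable mu : {measure set T -> \bar R}.

Lemma negligible_bigcup_countType (I : countType) (F : I -> set T) :
  (forall i, mu.-negligible (F i)) -> mu.-negligible (\bigcup_i F i).
Proof.
move=> F0; pose G n := if unpickle n is Some i then F i else set0.
apply: (@negligibleS _ _ _ mu (\bigcup_n G n)).
  by move=> x [i _ Fix]; exists (pickle i) => //; rewrite /G pickleK.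
apply: negligible_bigcup => n; rewrite /G.
by case: unpickle => [i|]; [exact: F0|exact: negligible_set0].
Qed.

Lemma le_measure_negligible (A B : set T) : measurable A -> measurable B ->
  mu.-negligible (A `\` B) -> (mu A <= mu B)%E.
Proof.
move=> mA mB /negligibleP AB0; rewrite -(@measureU0 _ _ _ mu B (A `\` B)) //.
- apply: le_measure; rewrite ?inE //; first by apply: measurableU => //; exact: measurableD.
  by move=> x Ax; have [Bx|nBx] := pselect (B x); [left|right].
- exact: measurableD.
- by apply: AB0; exact: measurableD.
Qed.

Lemma eq_measure_negligible (A B : set T) : measurable A -> measurable B ->
  mu.-negligible (A `\` B) -> mu.-negligible (B `\` A) -> mu A = mu B.
Proof.
by move=> mA mB AB BA; apply/eqP; rewrite eq_le !le_measure_negligible.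
Qed.

End negligible_sets.

(** * Open sets of the plane and the null complement of the support *)

Section plane.
Context {R : realType}.
Local Notation borelR := (measurableTypeR R).
Local Notation borelR2 := (measurableTypeR R * measurableTypeR R)%type.
Implicit Types (g : {measure set borelR2 -> \bar R}).

Definition rational_box (q : rat * rat * (rat * rat)) : set (R * R) :=
  [set` `]ratr q.1.1, ratr q.1.2[ ] `*` [set` `]ratr q.2.1, ratr q.2.2[ ].

Lemma measurable_rational_box q : measurable (rational_box q : set borelR2).
Proof. by apply: measurableX; exact: measurable_itv. Qed.

Lemma open_rational_box (U : set (R * R)) z : open_nbhs z U ->
  exists2 q, rational_box q z & rational_box q `<=` U.
Proof.
move=> /open_nbhs_nbhs /nbhs_ballP [e /= e0 zU].
have ltl (x : R) : x - e < x by rewrite ltrBlDr ltrDl.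
have ltr (x : R) : x < x + e by rewrite ltrDl.
have [q1 q1z] := rat_in_itvoo (ltl z.1).
have [q2 q2z] := rat_in_itvoo (ltr z.1).
have [q3 q3z] := rat_in_itvoo (ltl z.2).
have [q4 q4z] := rat_in_itvoo (ltr z.2).
move: q1z q2z q3z q4z; rewrite !in_itv /= => /andP[? ?] /andP[? ?] /andP[? ?] /andP[? ?].
exists (q1, q2, (q3, q4)).
  by split; rewrite /= in_itv /=; apply/andP; split.
move=> [x y] [] /=; rewrite !in_itv /= => /andP[? ?] /andP[? ?].
apply: zU; split; rewrite /ball /= ltr_norml; lra.
Qed.

(** Rational boxes form a countable base, so open sets of the product topology belong to the product
    sigma-algebra. *)
Lemma open_measurable2 (U : set (R * R)) : open U -> measurable (U : set borelR2).
Proof.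
move=> oU.
have -> : U = \bigcup_(n in [set n | exists2 q, unpickle n = Some q & rational_box q `<=` U])
    if unpickle n is Some q then rational_box q else set0.
  apply/seteqP; split=> [z Uz|z [n [q -> qU]] /qU //].
  have [q qz qU] := open_rational_box (conj oU Uz).
  by exists (pickle q); [exists q => //; exact: pickleK|rewrite pickleK].
apply: bigcup_measurable => n [q -> _]; exact: measurable_rational_box.
Qed.

(** Each point of [U] has a neighbourhood of measure zero, hence lies in a null rational box, and
    there are countably many boxes. *)
Lemma negligible_spt g (U : set (R * R)) : open U ->
  (forall z, U z -> ~ spt (g : set (R * R) -> \bar R) z) -> g.-negligible (U : set borelR2).
Proof.
move=> oU Ug.
(* Boxes charged by [g] are replaced by the empty set, so that the union runs over a full countable
   type. *)
apply: (@negligibleS _ _ _ g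
  (\bigcup_q (if `[< g (rational_box q) = 0%E >] then rational_box q else set0))); last first.
  apply: negligible_bigcup_countType => q; case: ifPn => [/asboolP q0|_].
    by apply/negligibleP => //; exact: measurable_rational_box.
  exact: negligible_set0.
move=> z Uz; have /existsNP [V /not_implyP[Vz]] := Ug z Uz.
move=> /negP; rewrite -leNgt => gV.
have [q qz qV] := open_rational_box Vz.
exists q => //; case: ifPn => // /asboolP []; apply/eqP; rewrite eq_le measure_ge0 andbT.
apply: le_trans gV; apply: le_measure; rewrite ?inE //.
  exact: measurable_rational_box.
by apply: open_measurable2; case: Vz.
Qed.

End plane.

(** * Plans, their supports and concentration within distance [l] *)

Section concentration.
Context {R : realType}.
Local Notation borelR := (measurableTypeR R).
Local Notation borelR2 := (measurableTypeR R * measurableTypeR R)%type.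
Implicit Types (g : {measure set borelR2 -> \bar R})
  (mu nu : {measure set borelR -> \bar R}).

Lemma measurable_fst_preimage (A : set borelR) : measurable A ->
  measurable (fst @^-1` A : set borelR2).
Proof. by move=> mA; rewrite -[X in measurable X]setTI; exact: measurable_fst. Qed.

Lemma measurable_snd_preimage (A : set borelR) : measurable A ->
  measurable (snd @^-1` A : set borelR2).
Proof. by move=> mA; rewrite -[X in measurable X]setTI; exact: measurable_snd. Qed.

Lemma plan_negligible_fst mu nu g (A : set borelR) : plan mu nu g ->
  mu.-negligible A -> g.-negligible (fst @^-1` A).
Proof.
move=> [g1 _] [N [mN N0 AN]]; exists (fst @^-1` N); split=> [||z /AN //].
  by rewrite -[X in measurable X]setTI; exact: measurable_fst.
by rewrite -N0 -g1.
Qed.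

Lemma plan_negligible_snd mu nu g (A : set borelR) : plan mu nu g ->
  nu.-negligible A -> g.-negligible (snd @^-1` A).
Proof.
move=> [_ g2] [N [mN N0 AN]]; exists (snd @^-1` N); split=> [||z /AN //].
  by rewrite -[X in measurable X]setTI; exact: measurable_snd.
by rewrite -N0 -g2.
Qed.

Lemma spt_plan mu nu g z : plan mu nu g -> spt (g : set (R * R) -> \bar R) z ->
  spt (mu : set R -> \bar R) z.1 /\ spt (nu : set R -> \bar R) z.2.
Proof.
move=> [g1 g2] gz; split=> U [oU Uz].
  rewrite -(g1 U (open_measurable oU)); apply: gz; split=> //.
  by apply: open_comp => // x _; exact: cvg_fst.
rewrite -(g2 U (open_measurable oU)); apply: gz; split=> //.
by apply: open_comp => // x _; exact: cvg_snd.
Qed.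

Definition concentrated (l : R) g :=
  g.-negligible ([set z : R * R | l < `|z.1 - z.2|] : set borelR2).

Lemma continuous_lin (u v : R) : continuous (fun z : R * R => u * z.1 + v * z.2).
Proof.
move=> z; apply: cvgD; apply: cvgM; try exact: cvg_cst.
  exact: cvg_fst.
exact: cvg_snd.
Qed.

Lemma open_halfplane (u v w : R) : open [set z : R * R | w < u * z.1 + v * z.2].
Proof.
apply: (@open_comp _ _ (fun z : R * R => u * z.1 + v * z.2) [set x | w < x]).
  by move=> z _; exact: continuous_lin.
exact: open_gt.
Qed.

Lemma open_dist_gt (l : R) : open [set z : R * R | l < `|z.1 - z.2|].
Proof.
have -> : [set z : R * R | l < `|z.1 - z.2|] =
    [set z : R * R | l < 1 * z.1 + (-1) * z.2] `|`
    [set z : R * R | l < (-1) * z.1 + 1 * z.2].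
  apply/seteqP; split=> z /=; rewrite lter_normr.
    by case/orP => ?; [left|right] => /=; lra.
  by case=> ?; apply/orP; [left|right] => /=; lra.
by apply: openU; exact: open_halfplane.
Qed.

(** The set of pairs at distance more than [l] is open and null, so it misses the support. *)
Lemma spt_concentrated l g z : concentrated l g ->
  spt (g : set (R * R) -> \bar R) z -> `|z.1 - z.2| <= l.
Proof.
move=> gl gz; rewrite leNgt; apply/negP => lz.
have := gz _ (conj (@open_dist_gt l) lz).
suff -> : g [set z0 : R * R | l < `|z0.1 - z0.2|] = 0%E by rewrite ltxx.
by apply: measure_negligible gl; apply: open_measurable2; exact: open_dist_gt.
Qed.

Lemma concentratedE l g : concentrated l g <-> (cost_infty g <= l%:E)%E.
Proof.
have E : ~` [set z : R * R | l < `|z.1 - z.2|] =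
    [set z : R * R | (`|z.1 - z.2|%:E <= l%:E)%E].
  by apply/seteqP; split=> z /=; rewrite lee_fin leNgt => /negP.
rewrite /concentrated -[X in _.-negligible X]setCK E.
by split=> [gl|/ess_supP //]; apply/ess_supP.
Qed.

(** A plan has mass one; for the zero measure the essential supremum would be [-oo]. *)
Lemma plan_cost_ge0 (mu : probability borelR R) nu g : plan mu nu g ->
  (0 <= cost_infty g)%E.
Proof.
move=> [g1 _]; apply: ess_sup_ger => //.
have -> : g setT = 1%E by rewrite -(probability_setT mu) -g1.
exact: lte01.
Qed.

Lemma compact_abs_le (A : set R) : compact A -> exists K, forall x, A x -> `|x| <= K.
Proof.
move=> /compact_bounded [K [_ /(_ (K + 1))]]; rewrite ltrDl ltr01 => /(_ isT) AK.
by exists (K + 1).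
Qed.

Lemma W_infty_fin (mu : probability borelR R) nu g :
  compact (spt (mu : set R -> \bar R)) -> compact (spt (nu : set R -> \bar R)) ->
  O_infty mu nu g -> W_infty mu nu = (lambdaC mu nu)%:E.
Proof.
move=> /compact_abs_le [K1 K1P] /compact_abs_le [K2 K2P] [pg gW].
have W0 := plan_cost_ge0 pg.
(* The support of [g] projects into the two compact supports, whose points are bounded by [K1] and
   [K2]. *)
have WK : (cost_infty g <= (K1 + K2)%:E)%E.
  apply/concentratedE; apply: negligible_spt; first exact: open_dist_gt.
  move=> z /= zK /(spt_plan pg) [/K1P z1 /K2P z2].
  have := ler_normB z.1 z.2; lra.
rewrite /lambdaC -gW fineK // ge0_fin_numE //; exact: le_lt_trans WK (ltry _).
Qed.

End concentration.

(** [M+] and [M-] are handled together as [Mplus (s * l) gbar] for a sign [s];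
    multiplying both coordinates by [s] reduces [s = -1] to [s = 1]. *)
Definition is_sign {R : realType} (s : R) := s = 1 \/ s = -1.

(** * Contact points and the constraints they put on concentrated plans *)

Section contact_sets.
Context {R : realType}.
Local Notation borelR := (measurableTypeR R).
Local Notation borelR2 := (measurableTypeR R * measurableTypeR R)%type.
Variables (mu nu : probability borelR R) (gbar : {measure set borelR2 -> \bar R}).
Variable l : R.
Hypothesis mu_atomless : forall x : R, mu [set x] = 0%E.
Hypothesis nu_atomless : forall x : R, nu [set x] = 0%E.
Hypothesis gbar_plan : plan mu nu gbar.
Hypothesis gbar_conc : concentrated l gbar.
Hypothesis gbar_monotone : infty_cyclically_monotone gbar.
Implicit Types (g : {measure set borelR2 -> \bar R}) (s t : R).

Local Notation M s := (Mplus (s * l) gbar).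

(** Exchanging the targets of [(t, t + s * l)] and [z] makes both distances smaller than [l],
    whereas the first pair is at distance exactly [l]; this contradicts cyclic monotonicity for a
    cycle of two points. *)
Lemma spt_no_crossing s t (z : R * R) : is_sign s -> M s t ->
  s * t < s * z.1 -> s * z.2 < s * t + l ->
  ~ spt (gbar : set (R * R) -> \bar R) z.
Proof.
move=> hs Mt tz zt gz.
have /ler_normlP [zl1 zl2] := spt_concentrated gbar_conc gz.
pose p (i : 'I_2) : R * R := if i == ord0 then (t, t + s * l) else z.
have pP : (forall i, spt (gbar : set (R * R) -> \bar R) (p i)) by move=> i; rewrite /p; case: ifP.
have := gbar_monotone pP.
rewrite !big_ord_recl !big_ord0 /p /=.
rewrite !ge_max => /and3P[+ _ _]; apply/negP; rewrite -ltNge.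
(* Indeed [s * t - l < s * z.1 - l <= s * z.2 < s * t + l]. *)
have l0 : 0 < l by move: tz zt; case: hs => ->; lra.
have -> : `|t - (t + s * l)| = l.
  by rewrite opprD addNKr normrN; case: hs => ->; rewrite normrM ?normrN normr1 mul1r gtr0_norm.
rewrite !gt_max l0 andbT !ltr_norml; move: tz zt; case: hs => -> tz zt; lra.
Qed.

Lemma measurable_halfline s c : measurable ([set x : R | s * x <= c] : set borelR).
Proof.
apply: closed_measurable; apply: (@preimage_closed _ _ (fun x : R => s * x) [set x | x <= c]).
  by move=> x _; apply: cvgM; [exact: cvg_cst|exact: cvg_id].
exact: closed_le.
Qed.

Lemma negligible_dist_gt g s c : concentrated l g -> is_sign s ->
  g.-negligible ([set z : R * R | s * z.1 <= c /\ c + l < s * z.2] : set borelR2).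
Proof.
move=> gl hs; apply: negligibleS gl => z /= [z1 z2].
by rewrite ltNge; apply/negP => /ler_normlP []; case: hs z1 z2 => ->; lra.
Qed.

Lemma negligible_snd1 g c : plan mu nu g ->
  g.-negligible (snd @^-1` [set c] : set borelR2).
Proof.
move=> pg; apply: (plan_negligible_snd pg).
by apply/negligibleP; [exact: measurable_set1|exact: nu_atomless].
Qed.

Lemma negligible_fst1 g c : plan mu nu g ->
  g.-negligible (fst @^-1` [set c] : set borelR2).
Proof.
move=> pg; apply: (plan_negligible_fst pg).
by apply/negligibleP; [exact: measurable_set1|exact: mu_atomless].
Qed.

(** The preimages of the two half-lines under the projections differ by a [gbar]-null set: one
    difference violates concentration, the other is a crossing. *)
Lemma contact_balance s t : is_sign s -> M s t ->
  mu [set x : R | s * x <= s * t] = nu [set y : R | s * y <= s * t + l].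
Proof.
move=> hs Mt; have [g1 g2] := gbar_plan.
rewrite -g1; last exact: measurable_halfline.
rewrite -g2; last exact: measurable_halfline.
rewrite /pushforward; apply: eq_measure_negligible.
- by apply: measurable_fst_preimage; exact: measurable_halfline.
- by apply: measurable_snd_preimage; exact: measurable_halfline.
- apply: negligibleS (negligible_dist_gt (s * t) gbar_conc hs) => z /= [z1 /negP].
  by rewrite -ltNge.
(* The absence of crossings empties the open quadrant [U] of support points; its edge on the line
   [y = t + s * l] is null because [nu] has no atoms. *)
pose U := [set z : R * R | s * t < s * z.1 + 0 * z.2] `&`
          [set z : R * R | - (s * t + l) < 0 * z.1 + - s * z.2].
have U0 : gbar.-negligible (U : set borelR2).
  apply: negligible_spt; first by apply: openI; exact: open_halfplane.
  move=> z [/= z1 z2]; apply: (spt_no_crossing hs Mt); lra.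
apply: negligibleS (negligibleU U0 (negligible_snd1 (t + s * l) gbar_plan)).
move=> z /= [z2 /negP]; rewrite -ltNge => z1.
move: z2; rewrite le_eqVlt => /orP[/eqP z2|z2]; [right => /=|left; split => /=; lra].
by move: z2; case: hs => ->; lra.
Qed.

(** The balance forces every concentrated plan, not only [gbar], to avoid the
    quadrant below the contact point. *)
Lemma negligible_crossing g s t : plan mu nu g -> concentrated l g ->
  is_sign s -> M s t ->
  g.-negligible ([set z : R * R | s * t < s * z.1 /\ s * z.2 <= s * t + l] : set borelR2).
Proof.
move=> pg gl hs Mt; have [g1 g2] := pg.
have mA := measurable_fst_preimage (measurable_halfline s (s * t)).
have mB := measurable_snd_preimage (measurable_halfline s (s * t + l)).
set A := (X in measurable X) in mA; set B := (X in measurable X) in mB.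
have gB : g B = g A.
  have := contact_balance hs Mt; rewrite -(g1 _ (measurable_halfline _ _)).
  by rewrite -(g2 _ (measurable_halfline _ _)) => /esym.
have -> : [set z : R * R | s * t < s * z.1 /\ s * z.2 <= s * t + l] = B `\` A.
  by apply/seteqP; split=> z /= [z1 z2]; split=> //; [apply/negP; rewrite -ltNge|rewrite ltNge; exact/negP].
suff BA : g (B `\` A) = 0%E by apply/negligibleP => //; exact: measurableD.
have gA : g A \is a fin_num.
  have <- : mu [set x : R | s * x <= s * t] = g A.
    by rewrite -(g1 _ (measurable_halfline _ _)).
  by apply: fin_num_measure; exact: measurable_halfline.
(* Concentration puts [A] inside [B] up to a null set; as both have the same finite mass, the
   difference is null. *)
have gBA : g (B `&` A) = g A.
  apply: eq_measure_negligible => //; first exact: measurableI.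
    by apply: negligibleS (@negligible_set0 _ _ _ g) => z [[]].
  apply: negligibleS (negligible_dist_gt (s * t) gl hs) => z /= [z1 /not_andP[|] //= /negP].
  by rewrite -ltNge.
have -> : g (B `\` A) = (g B - g (B `&` A))%E.
  by apply: measureD => //; apply: (@le_lt_trans _ _ (g A)); rewrite ?ltey_eq ?gA // -gB.
by rewrite gBA gB subee.
Qed.

Lemma mu_negligible_subset1 (A : set borelR) :
  (forall x y, A x -> A y -> x = y) -> mu.-negligible A.
Proof.
move=> A1; have [[x Ax]|nA] := pselect (exists x, A x); last first.
  by apply: negligibleS (negligible_set0 mu) => x Ax; apply: nA; exists x.
apply: (@negligibleS _ _ _ mu [set x : borelR]) => [y Ay|]; first exact: A1.
by apply/negligibleP; [exact: measurable_set1|exact: mu_atomless].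
Qed.

(** One-sided isolation: [x] is the first contact point beyond [q] in the direction [s]. Indexing by
    [q] leaves at most one point in each set. *)
Definition isolated s (q : rat) : set R := [set x | M s x /\ ratr q < s * x /\
  forall t, M s t -> ratr q < s * t -> s * x <= s * t].

Definition rational_contact s (q : rat * rat) : set R :=
  [set t | M s t /\ ratr q.1 < s * t < ratr q.2].

(** A point [(x, y)] with [x] in [M s] and [y] on the near side of [x + s * l]
    lies in the forbidden quadrant of some contact point [t], which can be
    picked in a countable set, unless [x] is isolated in [M s] on one side; the
    set of such isolated points is countable, hence [mu]-null. *)
Lemma negligible_off_graph g s : plan mu nu g -> concentrated l g -> is_sign s ->
  g.-negligible ([set z : R * R | M s z.1 /\ z.2 != z.1 + s * l] : set borelR2).
Proof.
move=> pg gl hs; pose t_ q := get (rational_contact s q).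
(* The guard discards windows without contact points, for which [get] returns a default value. *)
pose F q : set (R * R) := if `[< exists t, rational_contact s q t >] then
  [set z : R * R | s * t_ q < s * z.1 /\ s * z.2 <= s * t_ q + l] else set0.
have F0 q : g.-negligible (F q : set borelR2).
  rewrite /F; case: ifPn => [/asboolP /getPex [Mt _]|_]; last exact: negligible_set0.
  exact: negligible_crossing.
have I0 q : g.-negligible (fst @^-1` (isolated s q : set borelR) : set borelR2).
  apply: (plan_negligible_fst pg); apply: mu_negligible_subset1 => x y [Mx [qx xm]] [My [qy ym]].
  by move: (xm _ My qy) (ym _ Mx qx); case: hs => ->; lra.
apply: negligibleS (negligibleU gl (negligibleU (negligible_bigcup_countType F0)
  (negligible_bigcup_countType I0))) => z /= [Mz z12].
have [zl|zl] := ltP l `|z.1 - z.2|; [by left|right].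
have {z12 zl} z21 : s * z.2 - l < s * z.1.
  rewrite lt_neqAle; apply/andP; split.
    by apply: contra z12 => /eqP z12; apply/eqP; move: z12; case: hs => ->; lra.
  by move/ler_normlP: zl => []; case: hs => ->; lra.
have [[t [Mt /andP[t1 t2]]]|nt] := pselect (exists t, M s t /\ s * z.2 - l < s * t < s * z.1).
  (* The rational window is chosen inside the interval from [s * z.2 - l] to [s * z.1], so whichever
     contact point [t_] picks in it also has [z] in its forbidden quadrant. *)
  have [q1 q1P] := rat_in_itvoo t1; have [q2 q2P] := rat_in_itvoo t2.
  move: q1P q2P; rewrite !in_itv /= => /andP[q1z q1t] /andP[q2t q2z].
  left; exists (q1, q2) => //; rewrite /F asboolT; last by exists t; split => //=; rewrite q1t.
  have /getPex : exists t, rational_contact s (q1, q2) t by exists t; split => //=; rewrite q1t.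
  by rewrite -/(t_ _) => -[_ /= /andP[? ?]] /=; split; lra.
(* With no contact point in between, any rational of that interval witnesses that [z.1] is
   isolated. *)
have [q] := rat_in_itvoo z21; rewrite in_itv /= => /andP[q1 q2].
right; exists q => //=; split => //; split => // t Mt qt; rewrite leNgt; apply/negP => tz.
by apply: nt; exists t; split=> //; rewrite tz andbT; lra.
Qed.

Lemma measurable_contact s : measurable (M s : set borelR).
Proof. exact: measurable_Mplus. Qed.

Lemma measurable_id_x_shift (e : R) (A : set borelR2) : measurable A ->
  measurable (id_x_shift e @^-1` A : set borelR).
Proof.
move=> mA; rewrite -[X in measurable X]setTI.
suff : measurable_fun setT (id_x_shift e : borelR -> borelR2) by apply.
apply/measurable_fun_pairP; split; first exact: measurable_id.
by apply: measurable_funD; [exact: measurable_id|exact: measurable_cst].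
Qed.

(** On the graph of [x + s * l] membership in [A] depends on [x] alone, and over [M s] the plan
    charges nothing else. *)
Lemma plan_on_contact g s (A : set borelR2) : plan mu nu g -> concentrated l g ->
  is_sign s -> measurable A ->
  g (A `&` fst @^-1` M s) = mu (id_x_shift (s * l) @^-1` A `&` M s).
Proof.
move=> pg gl hs mA; have [g1 _] := pg.
have mB : measurable (id_x_shift (s * l) @^-1` A `&` M s : set borelR).
  by apply: measurableI; [exact: measurable_id_x_shift|exact: measurable_contact].
rewrite -(g1 _ mB) /pushforward; apply: eq_measure_negligible.
- by apply: measurableI => //; apply: measurable_fst_preimage; exact: measurable_contact.
- exact: measurable_fst_preimage.
- apply: negligibleS (negligible_off_graph pg gl hs) => -[x y] /= [[Axy Mx] nA].
  by split=> //; apply/eqP => E; apply: nA; rewrite /id_x_shift -E.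
apply: negligibleS (negligible_off_graph pg gl hs) => -[x y] /= [[Axy Mx] nA].
by split=> //; apply/eqP => E; apply: nA; rewrite E.
Qed.

(** No mass passes across the corner [(t, u)]. This form forgets the sign of the contact and also
    covers the corners given by the bounds of the supports. *)
Definition separates g (t u : R) :=
  g.-negligible ([set z : R * R | t < z.1 /\ z.2 < u] : set borelR2) /\
  g.-negligible ([set z : R * R | z.1 < t /\ u < z.2] : set borelR2).

(** One quadrant is null by the crossing bound and the other by concentration; the sign [s] decides
    which is which. *)
Lemma contact_separates g s t : plan mu nu g -> concentrated l g -> is_sign s ->
  M s t -> separates g t (t + s * l).
Proof.
move=> pg gl hs Mt.
have C := negligible_crossing pg gl hs Mt.
have D := negligible_dist_gt (s * t) gl hs.
by case: hs C D => -> C D; split;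
  [move: C|move: D|move: D|move: C]; apply: negligibleS => z /= [? ?]; lra.
Qed.

(** The two corners force almost every point over the first interval into the second and conversely;
    the edges are null since neither marginal has atoms. *)
Lemma eq_measure_separated g (p q : R * R) (B : set borelR) : plan mu nu g ->
  separates g p.1 q.1 -> separates g p.2 q.2 -> measurable B ->
  g (snd @^-1` B `&` fst @^-1` [set` `[p.1, p.2]]) = nu (B `&` [set` `[q.1, q.2]]).
Proof.
move=> pg [p1 q1] [p2 q2] mB; have [_ g2] := pg.
have mC : measurable (B `&` [set` `[q.1, q.2]] : set borelR).
  by apply: measurableI => //; exact: measurable_itv.
rewrite -(g2 _ mC) /pushforward; apply: eq_measure_negligible.
- by apply: measurableI; [exact: measurable_snd_preimage|apply: measurable_fst_preimage; exact: measurable_itv].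
- exact: measurable_snd_preimage.
- apply: negligibleS (negligibleU (negligibleU p1 q2)
    (negligibleU (negligible_fst1 p.1 pg) (negligible_fst1 p.2 pg))) => z /=.
  rewrite !in_itv /= => -[[Bz /andP[]]].
  rewrite le_eqVlt => /orP[/eqP z1|z1]; first by right; left.
  rewrite le_eqVlt => /orP[/eqP z2|z2]; first by right; right.
  move=> /not_andP[//|/negP]; rewrite negb_and -!ltNge.
  by case/orP => ?; left; [left|right].
apply: negligibleS (negligibleU (negligibleU q1 p2)
    (negligibleU (negligible_snd1 q.1 pg) (negligible_snd1 q.2 pg))) => z /=.
rewrite !in_itv /= => -[[Bz /andP[]]].
rewrite le_eqVlt => /orP[/eqP z1|z1]; first by right; left.
rewrite le_eqVlt => /orP[/eqP z2|z2]; first by right; right.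
move=> /not_andP[//|/negP]; rewrite negb_and -!ltNge.
by case/orP => ?; left; [left|right].
Qed.

End contact_sets.

(** * Complementary intervals of a closed set *)

Section gaps.
Context {R : realType}.
Variables (a b : R) (M : set R).
Hypothesis closedM : closed M.
Implicit Types (p q : R * R).

Lemma closed_last (E : set R) (x : R) : closed E -> (exists m, E m /\ m <= x) ->
  exists p : R, [/\ E p, p <= x & forall m, E m -> m <= x -> m <= p].
Proof.
move=> cE L0; pose L := E `&` [set m | m <= x].
have ubL : has_ubound L by exists x => m [].
have [Esup supx] : L (sup L).
  by apply: (closedI cE (closed_le (y := x))); apply: closure_sup.
by exists (sup L); split=> // m Em mx; exact: (ub_le_sup ubL).
Qed.

Lemma closed_first (E : set R) (x : R) : closed E -> (exists m, E m /\ x <= m) ->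
  exists p : R, [/\ E p, x <= p & forall m, E m -> x <= m -> p <= m].
Proof.
move=> cE [m [Em xm]].
have [||p [Ep px pP]] := @closed_last [set y | E (- y)] (- x).
- by apply: (@preimage_closed _ _ -%R E) => // y _; exact: opp_continuous.
- by exists (- m); rewrite /= opprK lerN2.
exists (- p); split=> //; first by rewrite lerNr.
by move=> k Ek xk; rewrite lerNl; apply: pP; rewrite /= ?opprK // lerN2.
Qed.

(** With [a] and [b] added, each point of [(a, b)] has a last point of the closed set before it and
    a first one after it. *)
Let E := M `|` [set a; b].

Let closedE : closed E.
Proof. by apply: closedU => //; apply: closedU; exact: closed_eq. Qed.

Let gap_avoid p m : gaps a b M p -> p.1 < m < p.2 -> ~ E m.
Proof.
move=> [_ /(_ m) pM _] pm.
have [] := pM; first by rewrite /= in_itv.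
by rewrite /= in_itv /= => /andP[am mb] nM [//|[me|me]]; move: am mb; rewrite me; lra.
Qed.

Let gap_around x : a < x < b -> ~ M x ->
  exists2 p, gaps a b M p & [/\ p.1 < x < p.2, E p.1 & E p.2].
Proof.
move=> /andP[ax xb] nMx.
have nEx : ~ E x by move=> [//|[xe|xe]]; move: ax xb; rewrite xe; lra.
(* The gap around [x] runs from the last point of [E] before [x] to the first one after it. *)
have [||u [Eu ux uP]] := @closed_last E x; [by []|by exists a; split; [right; left|lra]|].
have [||v [Ev xv vP]] := @closed_first E x; [by []|by exists b; split; [right; right|lra]|].
have {}ux : u < x by rewrite lt_neqAle ux andbT; apply/eqP => ux'; rewrite ux' in Eu.
have {}xv : x < v by rewrite lt_neqAle xv andbT; apply/eqP => xv'; rewrite -xv' in Ev.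
have au : a <= u by apply: uP; [right; left|exact: ltW].
have vb : v <= b by apply: vP; [right; right|exact: ltW].
exists (u, v); last by split=> //=; rewrite ux.
split=> /= [|m|[q1 q2] /= uvq qM]; first lra.
  rewrite /= !in_itv /= => /andP[um mv]; split; first by apply/andP; split; lra.
  move=> Mm; have [mx|xm] := leP m x.
    by have := uP m (or_introl Mm) mx; lra.
  by have := vP m (or_introl Mm) (ltW xm); lra.
have /= xq : x \in `]q1, q2[ by apply: uvq; rewrite /= in_itv /= ux.
(* A larger admissible interval still avoids [E] and contains [x], so it cannot extend past [u] or
   [v]. *)
have nq m : E m -> q1 < m < q2 -> False.
  move=> Em mq; have [] := qM m; first by rewrite /= in_itv.
  by case: Em => [//|[->|->]]; rewrite /= in_itv /= ltxx ?andbF.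
have {}xq : q1 < x < q2 by move: xq; rewrite in_itv.
have uq : u <= q1 by rewrite leNgt; apply/negP => qu; apply: (nq u) => //; lra.
have qv : q2 <= v by rewrite leNgt; apply/negP => vq; apply: (nq v) => //; lra.
have sub m : u < m < v -> q1 < m < q2.
  by move=> um; have := uvq m; rewrite /= !in_itv /=; exact.
(* Otherwise the midpoint of [u] and [q1] would lie in [(u, v)] but not in [(q1, q2)]. *)
have qu : q1 <= u.
  rewrite leNgt; apply/negP => uq'; have /andP[] : q1 < (u + q1) / 2 < q2 by apply: sub; lra.
  lra.
have vq : v <= q2.
  rewrite leNgt; apply/negP => uq'; have /andP[] : q1 < (v + q2) / 2 < q2 by apply: sub; lra.
  lra.
by congr pair; apply/eqP; rewrite eq_le ?uq ?qu ?vq ?qv.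
Qed.

Lemma gap_cover x : a < x < b -> ~ M x -> exists2 p, gaps a b M p & p.1 < x < p.2.
Proof. by move=> xab /(gap_around xab) [p pM []]; exists p. Qed.

(** The gap built around the midpoint of [p] has its ends in [E] and contains [p], which has no
    point of [E] inside; maximality identifies the two. *)
Lemma gap_ends p : gaps a b M p ->
  (p.1 = a \/ M p.1) /\ (p.2 = b \/ M p.2).
Proof.
move=> pg; have [p12 pM pmax] := pg.
have [xab nMx] : (`]a, b[ `\` M) ((p.1 + p.2) / 2).
  by apply: pM; rewrite /= in_itv /=; lra.
move: xab; rewrite /= in_itv /= => xab.
have [q qg [qx Eq1 Eq2]] := gap_around xab nMx.
have q1 : q.1 <= p.1.
  by rewrite leNgt; apply/negP => pq; apply: (gap_avoid pg _ Eq1); lra.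
have q2 : p.2 <= q.2.
  by rewrite leNgt; apply/negP => pq; apply: (gap_avoid pg _ Eq2); lra.
have [_ qM _] := qg.
have pq : q = p by apply: pmax => // m; rewrite /= !in_itv /= => ?; lra.
rewrite pq in Eq1 Eq2; split.
  by case: Eq1 => [|[|p1b]]; [right|left|move: p12 xab; rewrite p1b; lra].
by case: Eq2 => [|[p2a|]]; [right|move: p12 xab; rewrite p2a; lra|left].
Qed.

(** Ends of gaps lie in [E], so neither of two overlapping gaps can have an end inside the other. *)
Lemma trivIset_gaps : trivIset (gaps a b M) (fun p => [set` `]p.1, p.2[]).
Proof.
move=> p q pg qg [x []]; rewrite /= !in_itv /= => xp xq.
have ends r : gaps a b M r -> E r.1 /\ E r.2.
  by move=> /gap_ends [r1 r2]; split; [case: r1 => [->|]|case: r2 => [->|]];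
    [right; left|left|right; right|left].
have [p1 p2] := ends _ pg; have [q1 q2] := ends _ qg.
have pq1 : p.1 <= q.1 by rewrite leNgt; apply/negP => ?; apply: (gap_avoid qg _ p1); lra.
have pq2 : q.2 <= p.2 by rewrite leNgt; apply/negP => ?; apply: (gap_avoid qg _ p2); lra.
have qp1 : q.1 <= p.1 by rewrite leNgt; apply/negP => ?; apply: (gap_avoid pg _ q1); lra.
have qp2 : p.2 <= q.2 by rewrite leNgt; apply/negP => ?; apply: (gap_avoid pg _ q2); lra.
by rewrite [p]surjective_pairing [q]surjective_pairing; congr pair; apply/eqP; rewrite eq_le ?pq1 ?qp1 ?pq2 ?qp2.
Qed.

Lemma countable_gaps : countable (gaps a b M).
Proof.
(* The default [setT] keeps every [B p] open and nonempty, as the countability criterion asks for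
   all indices. *)
pose B p : set R := if p.1 < p.2 then [set` `]p.1, p.2[] else setT.
apply: (@separated_open_countable _ _ B) => [p|p|].
- by rewrite /B; case: ifP => _; [exact: interval_open|exact: openT].
- rewrite /B; case: ifPn => [p12|_]; last by exists 0.
  by exists ((p.1 + p.2) / 2); rewrite /= in_itv /=; lra.
move=> p q pg qg; have [p12 _ _] := pg; have [q12 _ _] := qg.
by rewrite /B p12 q12; exact: trivIset_gaps.
Qed.

End gaps.

(** * Countable additivity over arbitrary countable index sets *)

Section countable_additivity.
Context {d : measure_display} {T : measurableType d} {R : realType}.
Variable mu : {measure set T -> \bar R}.

Lemma bigcup_countable_reindex (I : pointedType) (D : set I) : countable D ->
  exists (B : set nat) (f : nat -> I), set_bij B D f.
Proof.
by move=> /countable_bijP[B]; rewrite card_eq_sym => /card_set_bijP[f]; exists B, f.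
Qed.

Lemma measurable_countable_bigcup (I : pointedType) (D : set I) (F : I -> set T) :
  countable D -> (forall i, D i -> measurable (F i)) ->
  measurable (\bigcup_(i in D) F i).
Proof.
move=> /bigcup_countable_reindex [B [f [Bf _ sf]]] mF.
rewrite (reindex_bigcup f B) //.
by apply: bigcup_measurable => n Bn; apply: mF; apply: Bf.
Qed.

Lemma measure_countable_bigcup (I : pointedType) (D : set I) (F : I -> set T) :
  countable D -> (forall i, D i -> measurable (F i)) -> trivIset D F ->
  mu (\bigcup_(i in D) F i) = \esum_(i in D) mu (F i).
Proof.
move=> /bigcup_countable_reindex [B [f bf]] mF tF; have [Bf injf sf] := bf.
rewrite (reindex_bigcup f B) // (reindex_esum B D f) // measure_bigcup.
- by rewrite nneseries_esum // set_mem_set.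
- by move=> n Bn; apply: mF; apply: Bf.
- rewrite (trivIset_comp F injf) (_ : f @` B = D) //.
  by apply/seteqP; split=> [_ [n Bn <-]|]; [exact: Bf|exact: sf].
Qed.

End countable_additivity.

(** * Optimal plans and their restrictions to the gaps *)

Section optimal_plans.
Context {R : realType}.
Local Notation borelR := (measurableTypeR R).
Local Notation borelR2 := (measurableTypeR R * measurableTypeR R)%type.
Variables (mu nu : probability borelR R) (gbar : {measure set borelR2 -> \bar R}).
Hypothesis mu_compact : compact (spt (mu : set R -> \bar R)).
Hypothesis nu_compact : compact (spt (nu : set R -> \bar R)).
Hypothesis mu_atomless : forall x : R, mu [set x] = 0%E.
Hypothesis nu_atomless : forall x : R, nu [set x] = 0%E.
Hypothesis gbar_optimal : O_infty mu nu gbar.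
Hypothesis gbar_monotone : infty_cyclically_monotone gbar.
Implicit Types (g : {measure set borelR2 -> \bar R}) (p : R * R).

Local Notation l := (lambdaC mu nu).
Local Notation I := (gap_index mu nu gbar).
Local Notation a := (inf (spt (mu : set R -> \bar R))).
Local Notation b := (sup (spt (mu : set R -> \bar R))).

(** The optimal plan [gbar] and the compact supports make the infimum finite, so that [l] is its
    true value; a plan of cost at most [l] then attains it. *)
Lemma O_inftyP g : O_infty mu nu g <-> plan mu nu g /\ concentrated l g.
Proof.
have Wl := W_infty_fin mu_compact nu_compact gbar_optimal.
split=> [[pg gW]|[pg /concentratedE gl]]; split=> //.
  by apply/concentratedE; rewrite gW Wl.
apply/eqP; rewrite eq_le {1}Wl gl /=.
by apply: ereal_inf_lbound; exists g.
Qed.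

Let gbar_plan : plan mu nu gbar. Proof. by have /O_inftyP[] := gbar_optimal. Qed.
Let gbar_conc : concentrated l gbar. Proof. by have /O_inftyP[] := gbar_optimal. Qed.

Lemma compact_inf_sup (A : set R) x : compact A -> A x -> inf A <= x <= sup A.
Proof.
move=> /compact_abs_le [K AK] Ax; apply/andP; split.
  by apply: ge_inf => //; exists (- K) => y /AK /ler_normlP[]; lra.
by apply: ub_le_sup => //; exists K => y /AK /ler_normlP[]; lra.
Qed.

Lemma negligible_outside g : plan mu nu g -> g.-negligible
  (~` [set z : R * R | a <= z.1 <= b /\
    inf (spt (nu : set R -> \bar R)) <= z.2 <= sup (spt (nu : set R -> \bar R))] : set borelR2).
Proof.
move=> pg; have sptC : g.-negligible (~` spt (g : set (R * R) -> \bar R) : set borelR2).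
  by apply: negligible_spt => //; apply: closed_openC; exact: closed_spt.
apply: negligibleS sptC => z /= nz gz; apply: nz.
by have [z1 z2] := spt_plan pg gz; split; exact: compact_inf_sup.
Qed.

Lemma closed_Mplus (e : R) : closed (Mplus e gbar).
Proof.
apply: (@preimage_closed R (R * R)%type (fun x => (x, x + e))); last exact: closed_spt.
move=> x _; apply: (@cvg_pair _ _ _ (nbhs x) (nbhs x) (nbhs (x + e)) _ _ _ id (fun y => y + e)).
  exact: cvg_id.
by apply: cvgD; [exact: cvg_id|exact: cvg_cst].
Qed.

Let closed_contact : closed (Mplus l gbar `|` Mminus l gbar).
Proof. by apply: closedU; exact: closed_Mplus. Qed.

Lemma Mplus_separates g t : plan mu nu g -> concentrated l g ->
  Mplus l gbar t -> separates g t (t + l).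
Proof.
move=> pg gl Mt; have := contact_separates (t := t) nu_atomless gbar_plan gbar_conc gbar_monotone pg gl (or_introl erefl).
by rewrite mul1r; exact.
Qed.

Lemma Mminus_separates g t : plan mu nu g -> concentrated l g ->
  Mminus l gbar t -> separates g t (t - l).
Proof.
move=> pg gl Mt; have := contact_separates (t := t) nu_atomless gbar_plan gbar_conc gbar_monotone pg gl (or_intror erefl).
by rewrite mulN1r; exact.
Qed.

(** At [a] both quadrants fall outside the rectangle spanned by the supports; any other left end is
    a contact point, of the sign selected by [lo]. *)
Lemma lo_separates g p : plan mu nu g -> concentrated l g -> I p ->
  separates g p.1 (lo mu nu gbar p).
Proof.
move=> pg gl Ip; rewrite /lo; case: eqVneq => [->|p1a].
  have out := negligible_outside pg.
  by split; apply: negligibleS out => z /= [? ?] [/andP[? ?] /andP[? ?]]; lra.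
case: ifPn => [|/negP pM]; first by rewrite inE; exact: Mplus_separates.
apply: Mminus_separates => //.
have [[p1|Mp] _] := gap_ends closed_contact Ip; first by rewrite p1 eqxx in p1a.
by case: Mp => // Mp; case: pM; rewrite inE.
Qed.

Lemma hi_separates g p : plan mu nu g -> concentrated l g -> I p ->
  separates g p.2 (hi mu nu gbar p).
Proof.
move=> pg gl Ip; rewrite /hi; case: eqVneq => [->|p2b].
  have out := negligible_outside pg.
  by split; apply: negligibleS out => z /= [? ?] [/andP[? ?] /andP[? ?]]; lra.
case: ifPn => [|/negP pM]; first by rewrite inE; exact: Mminus_separates.
apply: Mplus_separates => //.
have [_ [p2|Mp]] := gap_ends closed_contact Ip; first by rewrite p2 eqxx in p2b.
by case: Mp => // Mp; case: pM; rewrite inE.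
Qed.

Lemma gap_marginal g p (B : set borelR) : plan mu nu g -> concentrated l g -> I p ->
  measurable B ->
  g (snd @^-1` B `&` fst @^-1` [set` `[p.1, p.2]]) = nu_gap mu nu gbar p B.
Proof.
move=> pg gl Ip mB.
exact: (@eq_measure_separated _ mu nu mu_atomless nu_atomless g p
  (lo mu nu gbar p, hi mu nu gbar p) B pg (lo_separates pg gl Ip) (hi_separates pg gl Ip) mB).
Qed.

Lemma measurable_gap p : measurable (fst @^-1` [set` `[p.1, p.2]] : set borelR2).
Proof. by apply: measurable_fst_preimage; exact: measurable_itv. Qed.

Definition plan_gap g p : {measure set borelR2 -> \bar R} := mrestr g (measurable_gap p).

Lemma plan_plan_gap g p : plan mu nu g -> concentrated l g -> I p ->
  plan (mu_gap mu p) (nu_gap mu nu gbar p) (plan_gap g p).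
Proof.
move=> pg gl Ip; split=> A mA; last exact: gap_marginal.
have [g1 _] := pg; rewrite /mu_gap /= /mrestr -g1 //.
by apply: measurableI => //; exact: measurable_itv.
Qed.

Lemma negligible_mrestr (d : measure_display) (T : measurableType d)
    (m : {measure set T -> \bar R}) (D A : set T) (mD : measurable D) :
  m.-negligible A -> (mrestr m mD : {measure set T -> \bar R}).-negligible A.
Proof.
move=> [N [mN N0 AN]]; exists N; split=> //=.
apply/eqP; rewrite eq_le measure_ge0 andbT /mrestr -N0.
by apply: le_measure; rewrite ?inE //; exact: measurableI.
Qed.

(** Both sides are the total mass of [gbar] on the strip over the gap. *)
Lemma gap_mass p : I p -> mu_gap mu p setT = nu_gap mu nu gbar p setT.
Proof.
move=> Ip; have [m1 m2] := plan_plan_gap gbar_plan gbar_conc Ip.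
exact: etrans (esym (m1 _ measurableT)) (m2 _ measurableT).
Qed.

(** * Decomposing and gluing plans when [l] is positive *)

Hypothesis l_gt0 : 0 < l.

(** Over such a point the plan would have to sit on both graphs, which are disjoint as [l > 0]. For
    [l = 0] the two contact sets coincide, and [glued] would count them twice. *)
Lemma negligible_two_contacts g : plan mu nu g -> concentrated l g ->
  g.-negligible (fst @^-1` (Mplus l gbar `&` Mminus l gbar) : set borelR2).
Proof.
move=> pg gl.
have G1 := negligible_off_graph mu_atomless nu_atomless gbar_plan gbar_conc gbar_monotone pg gl (or_introl erefl).
have G2 := negligible_off_graph mu_atomless nu_atomless gbar_plan gbar_conc gbar_monotone pg gl (or_intror erefl).
apply: negligibleS (negligibleU G1 G2) => z /= [z1 z2].
have [zz|zz] := eqVneq z.2 (z.1 + l); last by left; rewrite mul1r.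
right; rewrite mulN1r; split=> //; rewrite zz; apply/eqP => /addrI ll.
by have := addr_gt0 l_gt0 l_gt0; rewrite {1}ll addNr ltxx.
Qed.

Definition glued g (g_ : R * R -> {measure set borelR2 -> \bar R}) :=
  forall A : set borelR2, measurable A ->
  g A = (pushforward (mrestr mu (measurable_Mplus l gbar)) (id_x_shift l) A +
         pushforward (mrestr mu (measurable_Mminus l gbar)) (id_x_shift (- l)) A +
         \esum_(p in I) g_ p A)%E.

(** Up to a null set, the strips over [M+], over [M-] without [M+] and over the open gaps partition
    the plane. *)
Lemma glued_plan_gap g : plan mu nu g -> concentrated l g -> glued g (plan_gap g).
Proof.
move=> pg gl A mA.
have mS (S : set R) : measurable (S : set borelR) -> measurable (A `&` fst @^-1` S : set borelR2).
  by move=> ?; apply: measurableI => //; exact: measurable_fst_preimage.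
have mP : measurable (Mplus l gbar : set borelR) by exact: measurable_Mplus.
have mN : measurable (Mminus l gbar : set borelR) by exact: measurable_Mminus.
have EP : g (A `&` fst @^-1` Mplus l gbar) =
    pushforward (mrestr mu (measurable_Mplus l gbar)) (id_x_shift l) A.
  have := plan_on_contact mu_atomless nu_atomless gbar_plan gbar_conc gbar_monotone pg gl (or_introl erefl) mA.
  by rewrite mul1r.
have EN : g (A `&` fst @^-1` Mminus l gbar) =
    pushforward (mrestr mu (measurable_Mminus l gbar)) (id_x_shift (- l)) A.
  have := plan_on_contact mu_atomless nu_atomless gbar_plan gbar_conc gbar_monotone pg gl (or_intror erefl) mA.
  by rewrite mulN1r.
(* Open gaps are disjoint while closed ones may share ends; the vertical lines over the ends are
   null. *)
pose F p : set borelR2 := A `&` fst @^-1` [set` `]p.1, p.2[].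
have mF p : measurable (F p) by apply: mS; exact: measurable_itv.
have cI : countable I := countable_gaps _ _ closed_contact.
have mG := measurable_countable_bigcup cI (fun p _ => mF p).
pose G := \bigcup_(p in I) F p; rewrite -/G in mG.
have EG : g G = \esum_(p in I) plan_gap g p A.
  rewrite measure_countable_bigcup //; last first.
    move=> p q Ip Iq [z [[_ zp] [_ zq]]].
    by apply: (trivIset_gaps closed_contact Ip Iq); exists z.1.
  apply: eq_esum => p Ip; apply: eq_measure_negligible => //.
  - by apply: mS; exact: measurable_itv.
  - apply: negligibleS (negligible_set0 g) => z [] [Az] /=.
    by rewrite !in_itv /= => /andP[/ltW z1 /ltW z2] [] ; rewrite z1 z2.
  apply: negligibleS (negligibleU (negligible_fst1 mu_atomless p.1 pg)
    (negligible_fst1 mu_atomless p.2 pg)) => z [] [Az] /=.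
  rewrite !in_itv /= => /andP[]; rewrite le_eqVlt => /orP[/eqP z1|z1]; first by left.
  rewrite le_eqVlt => /orP[/eqP z2|z2 nF]; first by right.
  by case: nF; split=> //; rewrite /= in_itv /= z1.
pose P := A `&` fst @^-1` Mplus l gbar.
pose N := A `&` fst @^-1` (Mminus l gbar `\` Mplus l gbar).
have mN' : measurable N by apply: mS; exact: measurableD.
have EN' : g N = g (A `&` fst @^-1` Mminus l gbar).
  apply: eq_measure_negligible => //; first exact: mS.
    by apply: negligibleS (negligible_set0 g) => z [[Az [Mz _]] []].
  apply: negligibleS (negligible_two_contacts pg gl) => z [[Az Mz] nz]; split=> //.
  by apply: contrapT => nP; apply: nz; split.
(* Apart from the outside of the rectangle and the lines over [a] and [b], every point lies over a
   contact point or a gap. *)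
have -> : g A = g (P `|` N `|` G).
  apply: eq_measure_negligible => //.
  - by apply: measurableU => //; apply: measurableU => //; exact: mS.
  - apply: negligibleS (negligibleU (negligible_outside pg)
      (negligibleU (negligible_fst1 mu_atomless a pg)
        (negligible_fst1 mu_atomless b pg))) => z [Az nz].
    have [za|za] := eqVneq z.1 a; first by right; left.
    have [zb|zb] := eqVneq z.1 b; first by right; right.
    left=> -[/andP[az zb'] _]; apply: nz.
    have [zP|nP] := pselect (Mplus l gbar z.1); first by left; left.
    have [zN|nN] := pselect (Mminus l gbar z.1); first by left; right.
    have [||p Ip zp] := @gap_cover _ a b _ closed_contact z.1.
    + by rewrite !lt_neqAle eq_sym za zb az.
    + by case.
    + by right; exists p => //; split=> //=; rewrite in_itv.
  by apply: negligibleS (negligible_set0 g) => z [[[[]|[]]|[p _ []]]].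
rewrite -EP -EN -EG -EN' measureU ?measureU //.
- exact: mS.
- by apply/seteqP; split=> z // [[_ z1] [_ [_ z2]]].
- by apply: measurableU => //; exact: mS.
apply/seteqP; split=> z // [PN [p Ip [_ zp]]].
have [_ /(_ z.1 zp) [_ nM] _] := Ip; apply: nM.
by case: PN => [[_ ?]|[_ [? _]]]; [left|right].
Qed.

(** On preimages under the projections, [g] and [gbar] have identical contact terms, and their gap
    terms agree as plans with the same marginals. *)
Lemma plan_glue g (g_ : R * R -> {measure set borelR2 -> \bar R}) :
  (forall p, I p -> plan (mu_gap mu p) (nu_gap mu nu gbar p) (g_ p)) ->
  glued g g_ ->
  plan mu nu g.
Proof.
move=> g_P gE.
have bP p Ip := plan_plan_gap gbar_plan gbar_conc (p := p) Ip.
have [b1 b2] := gbar_plan; split=> A mA.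
  have mA1 := measurable_fst_preimage mA.
  rewrite -(b1 A mA) /pushforward (gE _ mA1) (glued_plan_gap gbar_plan gbar_conc mA1).
  congr (_ + _)%E; apply: eq_esum => p Ip.
  exact: etrans ((g_P p Ip).1 A mA) (esym ((bP p Ip).1 A mA)).
have mA2 := measurable_snd_preimage mA.
rewrite -(b2 A mA) /pushforward (gE _ mA2) (glued_plan_gap gbar_plan gbar_conc mA2).
congr (_ + _)%E; apply: eq_esum => p Ip.
exact: etrans ((g_P p Ip).2 A mA) (esym ((bP p Ip).2 A mA)).
Qed.

Lemma concentrated_glue g (g_ : R * R -> {measure set borelR2 -> \bar R}) :
  (forall p, I p -> concentrated l (g_ p)) ->
  glued g g_ ->
  concentrated l g.
Proof.
move=> g_l gE; have mD := open_measurable2 (@open_dist_gt R l).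
apply/negligibleP => //; have := gE _ mD => /= ->.
(* Points of the two graphs are at distance exactly [l], so the contact terms do not charge the
   set. *)
have shift0 (e : R) (D : set borelR) : `|e| = l ->
    mu (id_x_shift e @^-1` [set z : R * R | l < `|z.1 - z.2|] `&` D) = 0%E.
  move=> el; rewrite (_ : _ `&` _ = set0) ?measure0 //.
  by apply/seteqP; split=> // x [] /=; rewrite opprD addNKr normrN el ltxx.
rewrite esum1 ?adde0; last by move=> p /g_l; exact: measure_negligible.
by rewrite /pushforward /mrestr !shift0 ?adde0 ?normrN ?gtr0_norm.
Qed.

End optimal_plans.

Unset Implicit Arguments.

Theorem theorem4p4 (R : realType) (mu nu : probability (measurableTypeR R) R)
  (gbar : {measure set (measurableTypeR R * measurableTypeR R) -> \bar R})
  (mu_compact : compact (spt (mu : set R -> \bar R)))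
  (nu_compact : compact (spt (nu : set R -> \bar R)))
  (mu_atomless : forall x : R, mu [set x] = 0%E)
  (nu_atomless : forall x : R, nu [set x] = 0%E)
  (gbar_optimal : O_infty mu nu gbar)
  (gbar_monotone : infty_cyclically_monotone gbar) :
  let l := lambdaC mu nu in
  let I := gap_index mu nu gbar in
  (forall p, I p -> mu_gap mu p setT = nu_gap mu nu gbar p setT) /\
  (0 < l ->
   forall g : {measure set (measurableTypeR R * measurableTypeR R) -> \bar R},
     O_infty mu nu g <->
     exists g_ : R * R ->
         {measure set (measurableTypeR R * measurableTypeR R) -> \bar R},
       (forall p, I p ->
          plan (mu_gap mu p) (nu_gap mu nu gbar p) (g_ p) /\
          {ae g_ p, forall z : R * R, `|z.2 - z.1| <= l}) /\
       (forall A : set (measurableTypeR R * measurableTypeR R), measurable A ->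
          g A =
            (pushforward (mrestr mu (measurable_Mplus l gbar)) (id_x_shift l) A +
             pushforward (mrestr mu (measurable_Mminus l gbar)) (id_x_shift (- l)) A +
             \esum_(p in I) g_ p A)%E)).
Proof.
move=> l I; split=> [p Ip|l_gt0 g].
  exact: gap_mass mu_compact nu_compact mu_atomless nu_atomless gbar_optimal gbar_monotone p Ip.
have optP := O_inftyP mu_compact nu_compact gbar_optimal g.
split=> [/optP [pg gl]|[g_ [g_P gE]]].
  exists (plan_gap g); split=> [p Ip|]; last first.
    exact: glued_plan_gap mu_compact nu_compact mu_atomless nu_atomless
      gbar_optimal gbar_monotone l_gt0 g pg gl.
  split; first exact: plan_plan_gap mu_compact nu_compact mu_atomless nu_atomless
    gbar_optimal gbar_monotone g p pg gl Ip.
  apply: negligible_mrestr; apply: negligibleS gl => z /= /negP.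
  by rewrite -ltNge distrC.
apply/optP; split.
  apply: (plan_glue mu_compact nu_compact mu_atomless nu_atomless
    gbar_optimal gbar_monotone l_gt0 _ gE) => p /g_P [].
  exact.
apply: (concentrated_glue l_gt0 _ gE) => p /g_P [_]; apply: negligibleS => z /=.
by rewrite ltNge distrC => /negP.
Qed.
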